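(* Let $V$ be a commutative nonassociative algebra over $\mathbb{R}$ with an associative inner product $\langle\cdot,\cdot\rangle$, i.e. a positive definite symmetric bilinear form with $\langle xy,z\rangle=\langle x,yz\rangle$ for all $x,y,z\in V$. Suppose $c\neq 0$ is an idempotent of $V$ and the Peirce eigenspace $V_c(1)=\{x\in V: cx=x\}$ is a subalgebra of $V$. Then $\dim V_c(1)=1$ if and only if $c$ is indecomposable.
   Context: An algebra over $\mathbb{R}$ is a real vector space with a bilinear multiplication $(x,y)\mapsto xy$; ''nonassociative'' means not necessarily associative. An element $c\in V$ is an idempotent if $c^2=cc=c$. An idempotent is called decomposable if it may be expressed as a sum of at least two nonzero idempotents; otherwise it is called indecomposable. A subalgebra is a linear subspace closed under multiplication.
   Formalization: V is taken finite-dimensional (false for R[x] with the integral inner product, c=1), and ''decomposable'' means a sum of at least two mutually orthogonal (zero product) nonzero idempotents, since for non-orthogonal sums of three the claim fails in R^3. *)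

(* Defs.v *)
From mathcomp Require Import all_boot all_order all_algebra.
From mathcomp Require Import reals.

Set Implicit Arguments.
Unset Strict Implicit.
Unset Printing Implicit Defensive.

Import GRing.Theory Num.Theory.
Local Open Scope ring_scope.

(* A finite-dimensional commutative, not necessarily associative, real algebra
   is a [vectType R] with a symmetric [mul : {bilinear V -> V -> V}].  The
   library's falgType / comAlgType do not apply: they are associative and
   unital. *)
Section NonassociativeAlgebra.
Variables (R : realType) (V : vectType R).
Implicit Types (mul : {bilinear V -> V -> V}) (c : V) (U : {vspace V}).

Definition commutative_mul mul := forall x y, mul x y = mul y x.

(* [{dot V for idfun}] consists of the positive definite symmetric bilinear
   forms, since over R the involution is the identity. *)
Definition associative_form mul (ip : {dot V for idfun}) :=
  forall x y z, ip (mul x y) z = ip x (mul y z).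

Definition idempotent_elt mul c := mul c c = c.

Definition peirce mul c (a : R) : {vspace V} := passmx.leigenspace (linfun (mul c)) a.

Definition subalgebra mul U := {in U &, forall x y, mul x y \in U}.

(* Decompositions are into mutually orthogonal idempotents (e_i e_j = 0).  For
   two summands this is automatic: e + f is idempotent iff 2 ef = 0.  For three
   or more it is not.  On R^3 put
     a_i a_i = a_i,  a_i a_j = a_i + a_j - 2 a_k,
     <x, y> = \sum_i x_i y_i + (\sum_i x_i) (\sum_i y_i);
   this form is associative, and c = a_1 + a_2 + a_3 is an idempotent whose
   multiplication operator is 1 on the line R c and 4 on c^\perp. *)
Definition decomposable mul c :=
  exists (n : nat) (e : 'I_n -> V),
    [/\ (2 <= n)%N,
        forall i, e i != 0 /\ idempotent_elt mul (e i),
        forall i j, i != j -> mul (e i) (e j) = 0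
      & c = \sum_(i < n) e i].

Definition indecomposable mul c := ~ decomposable mul c.

Lemma memv_peirce mul c (a : R) x :
  reflect (mul c x = a *: x) (x \in peirce mul c a).
Proof.
rewrite memv_ker add_lfunE opp_lfunE scale_lfunE id_lfunE lfunE subr_eq0; exact: eqP.
Qed.

Lemma memv_peirce1 mul c x : reflect (mul c x = x) (x \in peirce mul c 1).
Proof. by apply: (iffP (memv_peirce _ _ _ _)); rewrite scale1r. Qed.

End NonassociativeAlgebra.

(* Main.v *)
Require Import Defs.
From HB Require Import structures.
From mathcomp Require Import all_boot all_order all_algebra.
From mathcomp Require Import reals.
From mathcomp Require Import classical_sets topology normedtype derive realfun.
From mathcomp Require Import ring lra.

(* Since c is a unit of W = V_c(1), a decomposition of c lives in W, which is
   impossible if W is a line.  Conversely, maximize the square of the cubic form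
   u(x) = <xx, x> against <x, x>^3 on W: a maximizer is a multiple of an
   idempotent e.  If e <> c, then c = e + (c - e).  But c itself is a maximizer
   only if W is a line: for y in W orthogonal to c with |y| = |c| and
   u(y) >= 0 one has u(c + y) >= 4 |c|^2 = 4 u(c) and |c + y|^2 = 2 |c|^2, so
   the ratio at c + y is at least twice the ratio at c. *)

Set Implicit Arguments.
Unset Strict Implicit.
Unset Printing Implicit Defensive.

Import Order.TTheory GRing.Theory Num.Theory.
Import numFieldNormedType.Exports.

Local Open Scope ring_scope.

(** * Extrema of ratios of homogeneous functions on row vectors *)

Section HomogeneousRatio.
Local Open Scope classical_set_scope.

Lemma continuous_expr (T : topologicalType) (R : realType) (f : T -> R) n :
  continuous f -> continuous (fun x => f x ^+ n).
Proof.
move=> fc x; apply: (@continuous_comp _ _ _ f (fun r => r ^+ n)).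
  exact: fc.
exact: exprn_continuous.
Qed.

(** Equal degrees make the ratio constant along rays, so it is enough to maximize it over the unit
    sphere, which is compact, and nonempty because [0 < n]. *)
Lemma homogeneous_ratio_max (R : realType) (n d : nat) (f g : 'rV[R]_n -> R) :
  (0 < n)%N -> continuous f -> continuous g ->
  (forall a v, f (a *: v) = a ^+ d * f v) ->
  (forall a v, g (a *: v) = a ^+ d * g v) ->
  (forall v, v != 0 -> 0 < g v) ->
  exists2 v, v != 0 & forall w, w != 0 -> f w / g w <= f v / g v.
Proof.
move=> n_gt0 fc gc fZ gZ g_gt0.
pose S := [set v : 'rV[R]_n | `|v| = 1].
have normalized w : w != 0 -> S (`|w|^-1 *: w).
  move=> w0; rewrite /S /= normrZ ger0_norm ?invr_ge0 ?normr_ge0 //.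
  by rewrite mulVf // normr_eq0.
have S_neq0 v : S v -> v != 0.
  by move=> Sv; rewrite -normr_eq0 Sv oner_eq0.
have S0 : S !=set0.
  exists (`|const_mx 1 : 'rV[R]_n|^-1 *: const_mx 1); apply: normalized.
  apply/eqP => /matrixP/(_ ord0 (Ordinal n_gt0)); rewrite !mxE.
  by move/eqP; rewrite oner_eq0.
have cptS : compact S.
  apply: bounded_closed_compact.
    by exists 1; split=> // M M1 v /= ->; exact: ltW.
  have -> : S = (fun v : 'rV[R]_n => `|v|) @^-1` [set 1] by [].
  apply: preimage_closed; last exact: closed_eq.
  by move=> v _; exact: norm_continuous.
have cont : {within S, continuous (fun v => f v / g v)}.
  apply: continuous_in_subspaceT => v /set_mem /S_neq0 /g_gt0 gv.
  by apply: (cvgM (fc v) (cvgV _ (gc v))); rewrite gt_eqF.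
have [v /set_mem Sv vmax] := EVT_max_rV S0 cptS cont.
exists v; first exact: S_neq0.
move=> w w0; have := vmax _ (mem_set (normalized w w0)).
have a0 : `|w|^-1 ^+ d != 0 by rewrite expf_neq0 // invr_eq0 normr_eq0.
by rewrite fZ gZ -mulf_div divff // mul1r.
Qed.

(* Applied once per argument, this makes multilinear forms continuous. *)
Lemma continuous_linear_arg (R : realType) (n : nat) (V : lmodType R)
    (b : 'I_n -> V) (f : 'rV[R]_n -> V -> R) :
  (forall v, linear_for *%R (f v)) -> (forall y, continuous (f^~ y)) ->
  continuous (fun v => f v (\sum_i v ord0 i *: b i)).
Proof.
move=> flin fc.
have -> : (fun v => f v (\sum_i v ord0 i *: b i))
        = (fun v => \sum_i v ord0 i * f v (b i)).
  apply/boolp.funext => v.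
  pose fv := GRing.isLinear.Build R V R *%R (f v) (flin v).
  pose F : {linear V -> R | *%R} := HB.pack (f v) fv.
  rewrite -[f v]/(F : V -> R) linear_sum.
  by apply: eq_bigr => i _; rewrite linearZ.
apply: continuous_big => [|i _ v]; first exact: add_continuous.
by apply: continuousM; [exact: coord_continuous | exact: fc].
Qed.

End HomogeneousRatio.

(** Fermat's criterion at an interior point of an interval around [x], with the analytic derivative
    of [p] identified with the formal one. *)
Lemma horner_min_deriv (R : realType) (p : {poly R}) (x : R) :
  (forall t, p.[x] <= p.[t]) -> p^`().[x] = 0.
Proof.
move=> pmin.
have : is_derive x 1 (horner p) 0.
  apply: (@derive1_at_min _ _ (x - 1) (x + 1)) => //; first by lra.
  by rewrite in_itv /=; apply/andP; split; lra.
move=> dp.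
by rewrite derivE derive1E derive_val.
Qed.

(** * The cubic form of the algebra and the idempotents at its extrema *)

Section AssociativeForm.
Variables (R : realType) (V : vectType R).
Variables (mul : {bilinear V -> V -> V}) (ip : {dot V for idfun}).
Hypothesis mulC : commutative_mul mul.
Hypothesis ip_assoc : associative_form mul ip.

Lemma dot_sym x y : ip x y = ip y x.
Proof. by rewrite hermC /= mul1r. Qed.

Lemma dotDl x y z : ip (x + y) z = ip x z + ip y z.
Proof. exact: linearDl. Qed.

Lemma dotZl a x y : ip (a *: x) y = a * ip x y.
Proof. exact: linearZl_LR. Qed.

Lemma dotDr x y z : ip x (y + z) = ip x y + ip x z.
Proof. exact: linearDr. Qed.

Lemma dotZr a x y : ip x (a *: y) = a * ip x y.
Proof. exact: linearZr_LR. Qed.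

Lemma dot_ge0 x : 0 <= ip x x.
Proof.
have [->|/(neq0_dnorm_gt0 (s:=ip))/ltW //] := eqVneq x 0.
by rewrite linear0r.
Qed.

Lemma dot_eq0 x : (ip x x == 0) = (x == 0).
Proof.
have [->|/(neq0_dnorm_gt0 (s:=ip)) x0] := eqVneq x 0.
  by rewrite linear0r eqxx.
by rewrite gt_eqF.
Qed.

Let cubic x := ip (mul x x) x.

Lemma dotDZ t x y :
  ip (x + t *: y) (x + t *: y) = ip x x + 2 * t * ip x y + t ^+ 2 * ip y y.
Proof.
rewrite dotDl !dotDr !(dotZl, dotZr) (dot_sym y x); ring.
Qed.

(** Commutativity and associativity make [ip (mul x y) z] symmetric in its three arguments, so the
    mixed terms combine binomially. The term linear in [t] shows that the gradient of [cubic] at [x]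
    is three times [mul x x]. *)
Lemma cubicDZ t x y : cubic (x + t *: y) =
  cubic x + 3 * t * ip (mul x x) y + 3 * t ^+ 2 * ip (mul y y) x
  + t ^+ 3 * cubic y.
Proof.
have xyx : ip (mul x y) x = ip (mul x x) y.
  by rewrite mulC ip_assoc dot_sym.
have xyy : ip (mul x y) y = ip (mul y y) x.
  by rewrite ip_assoc dot_sym.
rewrite /cubic.
have -> : mul (x + t *: y) (x + t *: y)
        = mul x x + t *: mul x y + t *: (mul x y + t *: mul y y).
  rewrite linearDl !linearDr !linearZl_LR !linearZr_LR /= (mulC y x).
  by rewrite scalerDr.
rewrite !(dotDl, dotDr, dotZl, dotZr) xyx xyy; ring.
Qed.

Lemma cubicZ a x : cubic (a *: x) = a ^+ 3 * cubic x.
Proof.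
rewrite /cubic.
have -> : mul (a *: x) (a *: x) = a *: (a *: mul x x).
  by rewrite linearZl_LR linearZr_LR.
rewrite !(dotZl, dotZr); ring.
Qed.

Lemma cubic0 : cubic 0 = 0.
Proof. by rewrite -[0 in LHS](scale0r 0) cubicZ expr0n /= mul0r. Qed.

(** In coordinates for a basis of [U], both [cubic] squared and the cube of the squared norm have
    degree 6. The inequality is cross-multiplied so that it also covers [y = 0]. *)
Lemma cubic_ratio_max (U : {vspace V}) : U != 0%VS ->
  exists x, [/\ x \in U, x != 0
    & forall y, y \in U ->
        cubic y ^+ 2 * ip x x ^+ 3 <= cubic x ^+ 2 * ip y y ^+ 3].
Proof.
move=> U_neq0.
pose phi (v : 'rV[R]_(\dim U)) := \sum_i v ord0 i *: (vbasis U)`_i.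
have phiZ a v : phi (a *: v) = a *: phi v.
  by rewrite scaler_sumr; apply: eq_bigr => i _; rewrite mxE scalerA.
have phi_neq0 v : v != 0 -> phi v != 0.
  apply: contra_neq => phiv0; apply/rowP => i; rewrite mxE.
  by have /freeP := basis_free (vbasisP U); apply.
have phiU v : phi v \in U.
  apply: memv_suml => i _.
  by rewrite memvZ // vbasis_mem // mem_nth // size_tuple.
have phi_surj y : y \in U -> exists v, phi v = y.
  move=> yU; exists (\row_i coord (vbasis U) i y).
  by rewrite [RHS](coord_vbasis yU); apply: eq_bigr => i _; rewrite mxE.
have dot_cont : continuous (fun v => ip (phi v) (phi v)).
  apply: (continuous_linear_arg (f := fun v => ip (phi v))) => [v|y].
    by move=> a x z; rewrite dotDr dotZr.
  apply: (continuous_linear_arg (f := fun _ z => ip z y)) => [v|z].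
    by move=> a x z; rewrite dotDl dotZl.
  exact: cst_continuous.
(* The three occurrences of [phi v] are freed one at a time, until only a constant function
   remains. *)
have cubic_cont : continuous (fun v => cubic (phi v)).
  apply: (continuous_linear_arg (f := fun v => ip (mul (phi v) (phi v)))) => [v|y].
    by move=> a x z; rewrite dotDr dotZr.
  apply: (continuous_linear_arg (f := fun v z => ip (mul (phi v) z) y)) => [v|z].
    by move=> a x z; rewrite linearPr dotDl dotZl.
  apply: (continuous_linear_arg (f := fun _ x => ip (mul x z) y)) => [v|x].
    by move=> a x x'; rewrite linearPl dotDl dotZl.
  exact: cst_continuous.
have [||||||v v0 vmax] := @homogeneous_ratio_max R (\dim U) 6
    (fun v => cubic (phi v) ^+ 2) (fun v => ip (phi v) (phi v) ^+ 3).
- by rewrite lt0n dimv_eq0.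
- exact: continuous_expr.
- exact: continuous_expr.
- by move=> a v; rewrite phiZ cubicZ; ring.
- by move=> a v; rewrite phiZ !(dotZl, dotZr); ring.
- by move=> v /phi_neq0 /(neq0_dnorm_gt0 (s:=ip)) v0; rewrite exprn_gt0.
exists (phi v); split=> //; first exact: phi_neq0.
move=> _ /phi_surj [w <-].
have [->|w0] := eqVneq w 0.
  have -> : phi 0 = 0 by rewrite -(scale0r 0) phiZ scale0r.
  rewrite cubic0 expr0n /= mul0r.
  by rewrite mulr_ge0 ?sqr_ge0 ?exprn_ge0 ?dot_ge0.
have pos u : u != 0 -> 0 < ip (phi u) (phi u) ^+ 3.
  by move=> /phi_neq0 /(neq0_dnorm_gt0 (s:=ip)) u0; rewrite exprn_gt0.
by have := vmax _ w0; rewrite ler_pdivrMr ?pos // mulrAC ler_pdivlMr ?pos.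
Qed.

(* The extremal [x] has [x x = lambda x], since the first variation of the ratio
   in the direction [z = x x - lambda x], which is orthogonal to [x], is a
   nonzero multiple of [ip z z]. *)
Lemma extremal_idempotent (U : {vspace V}) :
  subalgebra mul U -> (exists2 y, y \in U & cubic y != 0) ->
  exists e, [/\ e \in U, e != 0, idempotent_elt mul e
    & forall y, y \in U -> cubic y ^+ 2 * ip e e <= ip y y ^+ 3].
Proof.
move=> Ualg [y0 y0U cy0].
have U_neq0 : U != 0%VS.
  apply: contra_neq cy0 => U0; move: y0U; rewrite U0 memv0 => /eqP ->.
  exact: cubic0.
have [x [xU x0 xmax]] := cubic_ratio_max U_neq0.
have n_gt0 : 0 < ip x x by exact: neq0_dnorm_gt0.
(* If the maximal ratio were zero, [cubic] would vanish at [y0]. *)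
have cx0 : cubic x != 0.
  have y0_gt0 : 0 < ip y0 y0.
    by apply: neq0_dnorm_gt0; apply: contra_neq cy0 => ->; exact: cubic0.
  apply/eqP => cx; have := xmax _ y0U.
  rewrite cx expr0n /= mul0r leNgt.
  rewrite mulr_gt0 //; [by rewrite exprn_even_gt0 | by rewrite exprn_gt0].
(* Pairing the desired equation [mul x x = l *: x] with [x] forces this value. *)
pose l := cubic x / ip x x.
have l0 : l != 0 by rewrite mulf_neq0 // invr_eq0 gt_eqF.
pose z := mul x x - l *: x.
have zU : z \in U by rewrite rpredB ?rpredZ ?Ualg.
have xz : ip x z = 0.
  rewrite /z -scaleNr dotDr dotZr dot_sym -/(cubic x) /l; field.
  by rewrite gt_eqF.
have xxz : ip (mul x x) z = ip z z.
  rewrite {2}/z -scaleNr dotDl dotZl xz; ring.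
have z0 : z = 0.
  (* The defect of the extremal inequality at [x + t *: z], as a polynomial in [t]; it is minimal at
     0. The norm has no linear term because [ip x z = 0], so only the cubic form contributes to the
     derivative there. *)
  pose p : {poly R} :=
    (cubic x ^+ 2)%:P * ((ip x x)%:P + (ip z z)%:P * 'X^2) ^+ 3
    - (ip x x ^+ 3)%:P * ((cubic x)%:P + (3 * ip z z)%:P * 'X
        + (3 * ip (mul z z) x)%:P * 'X^2 + (cubic z)%:P * 'X^3) ^+ 2.
  have pE t : p.[t] = cubic x ^+ 2 * ip (x + t *: z) (x + t *: z) ^+ 3
                      - cubic (x + t *: z) ^+ 2 * ip x x ^+ 3.
    by rewrite cubicDZ dotDZ xz xxz /p !hornerE /=; ring.
  have p0 : p.[0] = 0 by rewrite pE scale0r addr0 mulrC subrr.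
  have /horner_min_deriv : forall t, p.[0] <= p.[t].
    move=> t; rewrite p0 pE subr_ge0; apply: xmax.
    by rewrite rpredD ?rpredZ.
  have -> : p^`().[0] = - 6 * ip x x ^+ 3 * cubic x * ip z z.
    by rewrite /p !poly.derivE !hornerE /=; ring.
  have coef_neq0 : - 6 * ip x x ^+ 3 * cubic x != 0.
    rewrite mulf_neq0 // mulf_neq0 //; first by rewrite oppr_eq0 pnatr_eq0.
    by rewrite expf_neq0 // gt_eqF.
  by move/eqP; rewrite mulf_eq0 (negPf coef_neq0) dot_eq0 => /eqP.
have xx : mul x x = l *: x by apply/eqP; rewrite -subr_eq0 -/z z0.
exists (l^-1 *: x); split.
- by rewrite rpredZ.
- by rewrite scaler_eq0 invr_eq0 negb_or l0.
- rewrite /idempotent_elt linearZl_LR linearZr_LR /= xx (scalerA _ l).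
  by rewrite mulVf // scale1r.
(* Since [cubic x = l * ip x x], a factor [ip x x ^+ 2] cancels. What remains is the claim times
   [l ^+ 2], because [ip x x] is [l ^+ 2] times the squared norm of the idempotent. *)
move=> y yU; have := xmax y yU.
have -> : cubic x = l * ip x x by rewrite /l divfK // gt_eqF.
have -> : cubic y ^+ 2 * ip x x ^+ 3 = ip x x ^+ 2 * (cubic y ^+ 2 * ip x x).
  by ring.
have -> : (l * ip x x) ^+ 2 * ip y y ^+ 3 = ip x x ^+ 2 * (l ^+ 2 * ip y y ^+ 3).
  by ring.
rewrite ler_pM2l ?exprn_gt0 // => le_l.
rewrite -(@ler_pM2l _ (l ^+ 2)) ?exprn_even_gt0 //; apply: le_trans le_l.
by rewrite !(dotZl, dotZr) le_eqVlt; apply/orP; left; apply/eqP; field.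
Qed.

End AssociativeForm.

Theorem theorem1p4 (R : realType) (V : vectType R)
    (mul : {bilinear V -> V -> V}) (ip : {dot V for idfun}) (c : V)
    (mulC : commutative_mul mul) (ip_assoc : associative_form mul ip)
    (c_neq0 : c != 0) (c_idem : idempotent_elt mul c)
    (subalg1 : subalgebra mul (peirce mul c 1)) :
  \dim (peirce mul c 1) = 1%N <-> indecomposable mul c.
Proof.
have cW : c \in peirce mul c 1 by apply/memv_peirce1.
split=> [dim1 [n [e [n_ge2 e_idem e_orth c_sum]]] | c_indec].
  have lineW : <[c]>%VS = peirce mul c 1.
    by apply/eqP; rewrite eqEdim -memvE cW dim_vline c_neq0 dim1.
  (* Orthogonality of the summands gives [mul c (e i) = e i], so [e i = a *: c] for some nonzero [a]
     with [a * a = a]. *)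
  have e_eq_c i : e i = c.
    have [ei0 eii] := e_idem i.
    have : e i \in peirce mul c 1.
      apply/memv_peirce1; rewrite mulC c_sum linear_sum (bigD1 i) //= eii.
      by rewrite big1 ?addr0 // => j ji; rewrite e_orth // eq_sym.
    rewrite -lineW => /vlineP[a ea]; move: eii ei0.
    rewrite /idempotent_elt ea linearZl_LR linearZr_LR /= c_idem scalerA.
    rewrite scaler_eq0 (negPf c_neq0) orbF => /eqP.
    rewrite -subr_eq0 -scalerBl scaler_eq0 (negPf c_neq0) orbF subr_eq0.
    move=> /eqP aa a0; suff -> : a = 1 by rewrite scale1r.
    by apply: (mulfI a0); rewrite mulr1.
  (* The summands of index 0 and 1 are orthogonal, yet both equal [c]. *)
  have := e_orth (Ordinal (ltnW n_ge2)) (Ordinal n_ge2) isT.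
  by rewrite !e_eq_c c_idem => /eqP; rewrite (negPf c_neq0).
have N_gt0 : 0 < ip c c by exact: neq0_dnorm_gt0.
have [|e [eW e0 ee emax]] := extremal_idempotent mulC ip_assoc subalg1.
  by exists c; rewrite // c_idem gt_eqF.
have ce : mul c e = e by apply/memv_peirce1.
have [ec|e_neq_c] := eqVneq e c; last first.
  (* As [c] fixes [e], the product of [e] and [c - e] is [e - e = 0], which also makes [c - e]
     idempotent. *)
  case: c_indec; exists 2; pose f := [:: e; c - e].
  have orth : mul e (c - e) = 0 by rewrite linearBr mulC ce ee subrr.
  exists (fun i => f`_i); split=> //.
  - move=> [[|[|//]] Hi] /=; split=> //; first by rewrite subr_eq0 eq_sym.
    by rewrite /idempotent_elt linearBl orth subr0 linearBr c_idem ce.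
  - by move=> [[|[|//]] Hi] [[|[|//]] Hj] //= _; rewrite // mulC.
  - by rewrite !big_ord_recl big_ord0 /= addr0 addrC subrK.
apply/eqP; apply/negPn/negP => dim1.
have [w wW wc] : exists2 w, w \in peirce mul c 1 & w \notin <[c]>%VS.
  apply/subvPn; apply: contra dim1 => Wc.
  suff -> : peirce mul c 1 = <[c]>%VS by rewrite dim_vline c_neq0.
  by apply/eqP; rewrite eqEsubv Wc -memvE.
pose y := w - (ip c w / ip c c) *: c.
have yW : y \in peirce mul c 1 by rewrite rpredB ?rpredZ.
have cy : ip c y = 0.
  by rewrite /y -scaleNr dotDr dotZr; field; rewrite gt_eqF.
have y_neq0 : y != 0.
  apply: contraNneq wc => /eqP; rewrite subr_eq0 => /eqP ->.
  by rewrite memvZ ?memv_line.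
have y_gt0 : 0 < ip y y by exact: neq0_dnorm_gt0.
(* The modulus of [t] gives [t *: y] the norm of [c]; its sign is free, and the cubic form is
   odd. *)
have [t [t2 ct]] : exists t : R, t ^+ 2 * ip y y = ip c c
    /\ 0 <= t ^+ 3 * ip (mul y y) y.
  pose s := Num.sqrt (ip c c / ip y y).
  have s_ge0 : 0 <= s by exact: sqrtr_ge0.
  have s2 : s ^+ 2 * ip y y = ip c c.
    by rewrite sqr_sqrtr ?divr_ge0 ?ltW // divfK // gt_eqF.
  have [k0|k0] := leP 0 (ip (mul y y) y).
    by exists s; rewrite mulr_ge0 ?exprn_ge0.
  exists (- s); rewrite sqrrN; split=> //.
  have -> : (- s) ^+ 3 * ip (mul y y) y = s ^+ 3 * - ip (mul y y) y by ring.
  by rewrite mulr_ge0 ?exprn_ge0 // oppr_ge0 ltW.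
have := emax (c + t *: y); rewrite rpredD ?rpredZ // => /(_ isT).
rewrite ec cubicDZ // dotDZ // c_idem cy.
have -> : ip (mul y y) c = ip y y.
  by rewrite ip_assoc mulC; move/memv_peirce1: yW => ->.
rewrite -(mulrA 3 (t ^+ 2)) t2.
(* The bound now says that [(4 N + k)^2 N] is at most [(2 N)^3]. Expanding the left side gives at
   least [16 N^3]; the next three facts supply the signs of its monomials. *)
move: (ip c c) (t ^+ 3 * _) N_gt0 ct => N k N_gt0 k_ge0.
have N3 : 0 < N ^+ 3 by rewrite exprn_gt0.
have N2k : 0 <= N ^+ 2 * k by rewrite mulr_ge0 ?sqr_ge0.
have Nk2 : 0 <= N * k ^+ 2 by rewrite mulr_ge0 ?sqr_ge0 ?ltW.
lra.
Qed.
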